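(* Let $(A,M)$ be an $\mathsf{AssBimod}$-pair over a field of characteristic $0$, with associative product $\mu$ on $A$ and left and right $A$-actions $l,r$ on $M$. Then for linear maps $\mu':A\otimes A\to A$, $l':A\otimes M\to M$, $r':M\otimes A\to M$, the sum $(\mu+\mu')+(l+l')+(r+r')$ corresponds to an $\mathsf{AssBimod}$-pair structure on $(A,M)$ (that is, $\mu+\mu'$ is an associative product on $A$ and $l+l'$, $r+r'$ make $M$ a bimodule over $(A,\mu+\mu')$) if and only if $\mu'+l'+r'$ is a Maurer-Cartan element in the differential graded Lie algebra $\big(\bigoplus_{k\ge0}C^{k|0}(A\oplus M,A\oplus M),\,d_{\mu+l+r},\,[\,,]\big)$.
   Context: An $\mathsf{AssBimod}$-pair $(A,M)$ consists of an associative algebra $A$ (not necessarily unital) and an $A$-bimodule $M$. Let $V=A\oplus M$. Gerstenhaber bracket on $\bigoplus_{n\ge0}\mathrm{Hom}(V^{\otimes n+1},V)$ (with $\mathrm{Hom}(V^{\otimes n+1},V)$ in degree $n$): for $f\in\mathrm{Hom}(V^{\otimes m+1},V)$, $g\in\mathrm{Hom}(V^{\otimes n+1},V)$, $(f\diamond g)(v_1,\ldots,v_{m+n+1})=\sum_{i=1}^{m+1}(-1)^{(i-1)n}f(v_1,\ldots,v_{i-1},g(v_i,\ldots,v_{i+n}),v_{i+n+1},\ldots,v_{m+n+1})$ and $[f,g]=f\diamond g-(-1)^{mn}g\diamond f$. This is a graded Lie algebra. $C^{k|0}(A\oplus M,A\oplus M)\subset\mathrm{Hom}(V^{\otimes k+1},V)$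 is the space of maps sending $A^{\otimes k+1}$ into $A$, sending every tensor product of $k$ copies of $A$ and one copy of $M$ (in any order) into $M$, and vanishing on all other tensor products of copies of $A$ and $M$; $\bigoplus_{k\ge0}C^{k|0}$ is a graded Lie subalgebra. The maps $\mu,l,r$ and $\mu',l',r'$ are extended by zero to $V\otimes V$, so that their sums lie in $C^{1|0}$. The differential is $d_{\mu+l+r}=[\mu+l+r,\,\cdot\,]$. A Maurer-Cartan element of a differential graded Lie algebra $(\mathfrak g,d,[\,,])$ is $x\in\mathfrak g^1$ with $dx+\frac12[x,x]=0$. *)

(* Defs.v *)
From HB Require Import structures.
From mathcomp Require Import all_boot all_order all_algebra.
From mathcomp Require Import functions.

Set Implicit Arguments.
Unset Strict Implicit.
Unset Printing Implicit Defensive.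

Import GRing.Theory.
Local Open Scope ring_scope.

Section BilinearSum.
Variables (K : fieldType) (U V W : lmodType K).

Definition bilin_add (f g : {bilinear U -> V -> W}) (u : U) (v : V) : W :=
  f u v + g u v.

Variables f g : {bilinear U -> V -> W}.

Lemma bilin_add_bilinear :
  bilinear_for (GRing.Scale.Law.clone _ _ *:%R _)
               (GRing.Scale.Law.clone _ _ *:%R _) (bilin_add f g).
Proof.
split=> [v|u] a x y; rewrite /bilin_add.
  by rewrite !linearPl /= scalerDr addrACA.
by rewrite !linearPr /= scalerDr addrACA.
Qed.

HB.instance Definition _ :=
  bilinear_isBilinear.Build K U V W _ _ (bilin_add f g) bilin_add_bilinear.

End BilinearSum.

Section AssBimod.
Variables (K : fieldType) (A M : lmodType K).

(* The algebra is not required to have a unit, so the algebra structures of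
   ssralg do not apply. *)
Record AssBimod_pair (mu : {bilinear A -> A -> A}) (l : {bilinear A -> M -> M})
    (r : {bilinear M -> A -> M}) : Prop := {
  prod_assoc : forall a b c : A, mu (mu a b) c = mu a (mu b c);
  left_act : forall (a b : A) (x : M), l (mu a b) x = l a (l b x);
  right_act : forall (x : M) (a b : A), r x (mu a b) = r (r x a) b;
  left_right_act : forall (a : A) (x : M) (b : A), r (l a x) b = l a (r x b)
}.

End AssBimod.

Section Gerstenhaber.
Variables (K : fieldType) (V : lmodType K).

(* Hom(V^(n+1), V), in degree n, is the subspace of the multilinear maps among
   all the functions cochain n. *)
Definition cochain (n : nat) : lmodType K := ('I_n.+1 -> V) -> V.

Definition multilinear (n : nat) (f : cochain n) : Prop :=
  forall (i : 'I_n.+1) (v : 'I_n.+1 -> V),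
    linear (fun x : V => f (fun j => if j == i then x else v j)).

(* Indices start at 0; all the arguments of inord are at most m + n, so inord
   never returns its default value. *)
Definition diamond (m n : nat) (f : cochain m) (g : cochain n) :
    cochain (m + n) :=
  fun v => \sum_(i < m.+1) (-1) ^+ (i * n) *:
    f (fun j : 'I_m.+1 =>
         if (j < i)%N then v (inord j)
         else if j == i then g (fun k : 'I_n.+1 => v (inord (i + k)))
         else v (inord (j + n))).

Definition cochain_cast (m n : nat) (e : m = n) (f : cochain m) : cochain n :=
  fun v => f (fun i => v (cast_ord (congr1 S e) i)).

Definition bracket (m n : nat) (f : cochain m) (g : cochain n) :
    cochain (m + n) :=
  diamond f g - (-1) ^+ (m * n) *: cochain_cast (addnC n m) (diamond g f).

Definition bracket_diff (theta : cochain 1) (n : nat) (f : cochain n) :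
    cochain n.+1 :=
  bracket theta f.

End Gerstenhaber.

(* The differential graded Lie algebra is given by its homogeneous components,
   the subspaces g n of E n, and by its operations d and br. *)
Definition maurer_cartan (K : fieldType) (E : nat -> lmodType K)
    (g : forall n, E n -> Prop) (d : forall n, E n -> E n.+1)
    (br : forall m n, E m -> E n -> E (m + n)%N) (x : E 1%N) : Prop :=
  g 1%N x /\ d 1%N x + 2^-1 *: br 1%N 1%N x x = 0.

Section Pair.
Variables (K : fieldType) (A M : lmodType K).

Notation V := (A * M)%type.

Definition in_A (x : V) : Prop := x.2 = 0.
Definition in_M (x : V) : Prop := x.1 = 0.

(* C^{k|0}; S is the set of the positions of the factors M in a tensor product
   of k + 1 copies of A and M. *)
Definition Ck0 (k : nat) (f : cochain V k) : Prop :=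
  multilinear f /\
  forall (S : {set 'I_k.+1}) (v : 'I_k.+1 -> V),
    (forall i, if i \in S then in_M (v i) else in_A (v i)) ->
    [/\ #|S| = 0%N -> in_A (f v),
        #|S| = 1%N -> in_M (f v)
      & (1 < #|S|)%N -> f v = 0].

Definition ext_prod (mu : A -> A -> A) : cochain V 1 :=
  fun v => (mu (v ord0).1 (v ord_max).1, 0).
Definition ext_left (l : A -> M -> M) : cochain V 1 :=
  fun v => (0, l (v ord0).1 (v ord_max).2).
Definition ext_right (r : M -> A -> M) : cochain V 1 :=
  fun v => (0, r (v ord0).2 (v ord_max).1).

Definition pair_cochain (mu : A -> A -> A) (l : A -> M -> M)
    (r : M -> A -> M) : cochain V 1 :=
  ext_prod mu + ext_left l + ext_right r.

End Pair.

(* Main.v *)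
(** Write P and P' for the 1-cochains mu + l + r and mu' + l' + r'. In degree 1
    the bracket is symmetric, [f, g] = f <> g + g <> f with <> the Gerstenhaber
    circle product, and the components of (P <> P)(u, v, w) in A and in M
    collect exactly the defects of associativity and of the three bimodule
    axioms. So (A, M) is a pair for P + P' iff
      0 = (P + P') <> (P + P') = P <> P + [P, P'] + 1/2 [P', P'],
    where P <> P = 0 by hypothesis. *)

Require Import Defs.
From mathcomp Require Import all_boot all_order all_algebra.
From mathcomp Require Import functions.
From mathcomp Require Import boolp.
Local Open Scope ring_scope.
Import GRing.Theory.

Lemma bracket11E (K : fieldType) (V : lmodType K) (f g : cochain V 1) :
  bracket f g = diamond f g + diamond g f.
Proof.
rewrite /bracket expr1 scaleN1r opprK; congr (_ + _).
(* [addnC 1 1] equates two identical degrees, so the cast changes only the bound proofs carried by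
   the ordinals. *)
apply/funext=> v; rewrite /cochain_cast; congr (diamond g f _).
by apply/funext=> i; congr v; apply/val_inj.
Qed.

Section PairCochains.
Variables (K : fieldType) (A M : lmodType K).
Implicit Types (mu : {bilinear A -> A -> A}) (l : {bilinear A -> M -> M}).
Implicit Type r : {bilinear M -> A -> M}.

Local Notation V := (A * M)%type.

Lemma pair_cochainE (mu : A -> A -> A) (l : A -> M -> M) (r : M -> A -> M)
    (v : 'I_2 -> V) :
  pair_cochain mu l r v =
  (mu (v ord0).1 (v ord_max).1,
   l (v ord0).1 (v ord_max).2 + r (v ord0).2 (v ord_max).1).
Proof.
by rewrite /pair_cochain !addrfctE; congr (_, _); rewrite /= ?addr0 ?add0r.
Qed.

Lemma pair_cochain_add mu mu' l l' r r' :
  pair_cochain (bilin_add mu mu') (bilin_add l l') (bilin_add r r') =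
  pair_cochain mu l r + pair_cochain mu' l' r'.
Proof.
apply/funext=> v; rewrite addrfctE !pair_cochainE.
by congr (_, _); rewrite /= addrACA.
Qed.

Lemma diamond_pairE (mu mu' : A -> A -> A) (l l' : A -> M -> M)
    (r r' : M -> A -> M) (v : 'I_3 -> V) (a := v ord0) (b := v (inord 1))
    (c := v ord_max) :
  diamond (pair_cochain mu l r) (pair_cochain mu' l' r') v =
  (mu (mu' a.1 b.1) c.1 - mu a.1 (mu' b.1 c.1),
   l (mu' a.1 b.1) c.2 + r (l' a.1 b.2 + r' a.2 b.1) c.1
   - (l a.1 (l' b.1 c.2 + r' b.2 c.1) + r a.2 (mu' b.1 c.1))).
Proof.
have v0 : v (inord 0) = a by congr (v _); apply/val_inj; rewrite /= inordK.
have v2 : v (inord 2) = c by congr (v _); apply/val_inj; rewrite /= inordK.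
rewrite /diamond !big_ord_recl big_ord0 addr0 expr0 scale1r expr1 scaleN1r.
by rewrite !pair_cochainE /= !(add0n, addn0) v0 v2.
Qed.

Lemma diamond_pairDl mu1 mu2 (mu : A -> A -> A) l1 l2 (l : A -> M -> M)
    r1 r2 (r : M -> A -> M) :
  diamond (pair_cochain mu1 l1 r1 + pair_cochain mu2 l2 r2)
    (pair_cochain mu l r) =
  diamond (pair_cochain mu1 l1 r1) (pair_cochain mu l r) +
  diamond (pair_cochain mu2 l2 r2) (pair_cochain mu l r).
Proof.
rewrite -pair_cochain_add; apply/funext=> v.
rewrite addrfctE !diamond_pairE; congr (_, _); rewrite /= /bilin_add.
  by rewrite opprD [LHS]addrACA.
by rewrite !(addrACA _ (l2 _ _)) opprD [LHS]addrACA.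
Qed.

(** Additivity in the outer argument is pointwise addition; in the inner one it rests on the
    bilinearity of [mu], [l] and [r]. *)
Lemma diamond_pairDr mu mu1 mu2 l l1 l2 r r1 r2 :
  diamond (pair_cochain mu l r)
    (pair_cochain mu1 l1 r1 + pair_cochain mu2 l2 r2) =
  diamond (pair_cochain mu l r) (pair_cochain mu1 l1 r1) +
  diamond (pair_cochain mu l r) (pair_cochain mu2 l2 r2).
Proof.
rewrite -pair_cochain_add; apply/funext=> v.
rewrite addrfctE !diamond_pairE; congr (_, _); rewrite /= /bilin_add.
  by rewrite linearDl linearDr opprD [LHS]addrACA.
(* The inner sums are first regrouped by the indices 1 and 2, so that each outer map splits into
   just two terms. *)
rewrite !(addrACA _ (l2 _ _)) 2!linearDl [l _ (_ + _)]linearDr [r _ (_ + _)]linearDr /=.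
by rewrite !(addrACA _ (l _ _)) opprD [LHS]addrACA.
Qed.

(** Triples with each entry in [A] or in [M] isolate the axioms: AAA gives associativity, AAM the
    left action, MAA the right action, AMA their compatibility. *)
Lemma diamond_pair_eq0 mu l r :
  diamond (pair_cochain mu l r) (pair_cochain mu l r) = 0 <->
  AssBimod_pair mu l r.
Proof.
split=> [D0|[muA lA rA lrA]]; last first.
  apply/funext=> v; rewrite diamond_pairE muA lA rA linearDl linearDr /= lrA.
  by rewrite subrr !addrA subrr.
pose w x y z : 'I_3 -> V := fun i => nth 0 [:: x; y; z] i.
have DE (x y z : V) :
    mu (mu x.1 y.1) z.1 - mu x.1 (mu y.1 z.1) = 0 /\
    l (mu x.1 y.1) z.2 + r (l x.1 y.2 + r x.2 y.1) z.1 -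
    (l x.1 (l y.1 z.2 + r y.2 z.1) + r x.2 (mu y.1 z.1)) = 0.
  have := congr1 (@^~ (w x y z)) D0.
  by rewrite diamond_pairE /w /= inordK // => -[].
split=> [a b c|a b x|x a b|a x b]; apply/eqP; rewrite -subr_eq0; apply/eqP.
- by have [] := DE (a, 0) (b, 0) (c, 0).
- by have [_ /=] := DE (a, 0) (b, 0) (0, x);
    rewrite !(linear0l, linear0r, addr0, add0r).
(* Here the axiom comes out with its two sides exchanged, hence the change of sign. *)
- have [_ /=] := DE (0, x) (a, 0) (b, 0).
  rewrite !(linear0l, linear0r, addr0, add0r) => /eqP.
  by rewrite -oppr_eq0 opprB => /eqP.
- by have [_ /=] := DE (a, 0) (0, x) (b, 0);
    rewrite !(linear0l, linear0r, addr0, add0r).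
Qed.

(** This settles the membership half of the Maurer-Cartan condition. With both entries in [M], every
    term has a zero argument. *)
Lemma Ck0_pair_cochain mu l r : Ck0 (pair_cochain mu l r).
Proof.
split=> [i v a x y|S v Sv].
  rewrite !pair_cochainE; congr (_, _).
    case: i => [[|[|//]] ?] /=.
      by rewrite linearPl.
    by rewrite linearPr.
  case: i => [[|[|//]] ?] /=.
    by rewrite !linearPl /= scalerDr addrACA.
  by rewrite !linearPr /= scalerDr addrACA.
(* As a sum of two bits, the cardinal computes in each of the four cases. *)
have -> : #|S| = ((ord0 \in S) + (ord_max \in S))%N.
  rewrite -sum1_card big_mkcond !big_ord_recl big_ord0 /= addn0.
  have -> : lift ord0 ord0 = ord_max :> 'I_2 by apply/val_inj.
  by do 2!case: (_ \in S).
have := Sv ord_max; have := Sv ord0; rewrite /in_A /in_M !pair_cochainE.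
by (do 2!case: (_ \in S)) => /= -> ->; split=> //= _;
  rewrite !(linear0l, linear0r, addr0, add0r).
Qed.

End PairCochains.

Theorem theorem3p5 (K : fieldType) (charK0 : [pchar K] =i pred0)
    (A M : lmodType K)
    (mu : {bilinear A -> A -> A}) (l : {bilinear A -> M -> M})
    (r : {bilinear M -> A -> M}) (pairAM : AssBimod_pair mu l r)
    (mu' : {bilinear A -> A -> A}) (l' : {bilinear A -> M -> M})
    (r' : {bilinear M -> A -> M}) :
  AssBimod_pair (bilin_add mu mu') (bilin_add l l') (bilin_add r r') <->
  maurer_cartan (@Ck0 K A M) (bracket_diff (pair_cochain mu l r))
    (@bracket K (A * M)%type) (pair_cochain mu' l' r').
Proof.
(* Characteristic 0 makes 2 invertible, so half of [bracket P' P'] is [diamond P' P']. *)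
have half2 : 2^-1 * 2%:R = 1 :> K.
  by rewrite mulVf // (proj1 (pcharf0P K) charK0).
rewrite -diamond_pair_eq0 pair_cochain_add.
set P := pair_cochain mu l r; set P' := pair_cochain mu' l' r'.
have -> : diamond (P + P') (P + P') =
    bracket_diff P P' + 2^-1 *: bracket P' P'.
  rewrite /bracket_diff !bracket11E -mulr2n -scaler_nat scalerA half2 scale1r.
  (* The outer [P + P'] is folded into a single [pair_cochain], the form that [diamond_pairDr]
     requires, and then unfolded again. *)
  rewrite -{1}pair_cochain_add diamond_pairDr pair_cochain_add !diamond_pairDl.
  by rewrite (proj2 (diamond_pair_eq0 _ _ _ _ _ _) pairAM) add0r addrCA addrA.
by split=> [|[]] //; split=> //; exact: Ck0_pair_cochain.
Qed.
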